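(* Let $k\ge 1$, $q\ge 3$, $\alpha\in[0,1]$, $\beta>0$, let $J_I(x,y),J_P(x,y)\in\mathbb R$ be couplings on the edges of the Cayley tree $\Gamma^k=(V,L)$ with root $x_0$, and let $\{\mathbf h_x\}_{x\in V}$ be a collection of vectors $\mathbf h_x=(h_{1,1,x},\dots,h_{1,q,x},h_{-1,1,x},\dots,h_{-1,q,x})\in\mathbb R^{2q}$. Let $\mu_n$, $n=1,2,\dots$, be the associated probability measures on $\Omega_{V_n}$ for the $(2,q)$-Ising-Potts model. For an edge $\langle x,y\rangle$ write $\theta_I=\theta_I(x,y)=\exp\{\beta J_I(x,y)\}$ and $\theta_P=\theta_P(x,y)=\exp\{\beta J_P(x,y)\}$, and put $z_{i,j,x}=\exp\{h_{i,j,x}-h_{-1,q,x}\}$ for $i\in\{-1,1\}$, $j\in\{1,\dots,q\}$. Then the measures $\mu_n$, $n=1,2,\dots$, satisfy the compatibility condition if and only if for every $x\in V\setminus\{x_0\}$ the following holds: for every $(i,j)\in\{-1,1\}\times\{1,\dots,q\}$ with $(i,j)\ne(-1,q)$, $$z_{i,j,x}=\prod_{y\in S(x)}\frac{\theta_I^{\alpha(1-i)}\left(\sum_{v=1}^{q}\left(\theta_I^{2\alpha i}z_{1,v,y}+z_{-1,v,y}\right)+\left(\theta_P^{1-\alpha}-1\right)\left(\theta_I^{2\alpha i}z_{1,j,y}+z_{-1,j,y}\right)\right)}{\sum_{v=1}^{q-1}\left(z_{1,v,y}+\theta_I^{2\alpha}z_{-1,v,y}\right)+\theta_P^{1-\alpha}\left(z_{1,q,y}+\theta_I^{2\alpha}\right)},$$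 while for $(i,j)=(-1,q)$, $z_{-1,q,x}=1$.
   Context: The Cayley tree $\Gamma^k=(V,L)$ of order $k\ge1$ is the infinite tree in which every vertex has exactly $k+1$ incident edges; $V$ is the vertex set and $L$ the edge set; $\langle x,y\rangle$ denotes an edge with endpoints $x,y$. Fix $x_0\in V$; $d$ is the graph distance. Put $W_n=\{x\in V: d(x,x_0)=n\}$, $V_n=\{x\in V: d(x,x_0)\le n\}$, $L_n=\{\langle x,y\rangle\in L: x,y\in V_n\}$, and for $x\in W_n$ let $S(x)=\{y\in W_{n+1}: d(x,y)=1\}$ (direct successors). Let $\Phi=\{-1,1\}$, $\Psi=\{1,\dots,q\}$ with $q\ge3$. A configuration on $A\subset V$ is a function $x\in A\mapsto(\sigma(x),s(x))\in\Phi\times\Psi$; $\Omega_A=(\Phi\times\Psi)^A$. For $(\sigma_{n-1},s_{n-1})\in\Omega_{V_{n-1}}$ and $(\sigma_{[n]},s_{[n]})\in\Omega_{W_n}$, the concatenation $(\sigma_{n-1},s_{n-1})\vee(\sigma_{[n]},s_{[n]})\in\Omega_{V_n}$ equals the first on $V_{n-1}$ and the second on $W_n$. The Hamiltonian of the $(2,q)$-Ising-Potts model is $$H_n(\sigma_n,s_n)=-\alpha\sum_{\langle x,y\rangle\in L_n}J_I(x,y)\sigma(x)\sigma(y)-(1-\alpha)\sum_{\langle x,y\rangle\in L_n}J_P(x,y)\delta_{s(x)s(y)},$$ where $\delta$ is the Kronecker delta. The measure $\mu_n$ on $\Omega_{V_n}$ is $$\mu_n(\sigma_n,s_n)=Z_n^{-1}\exp\Big\{-\beta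 H_n(\sigma_n,s_n)+\sum_{x\in W_n}h_{\sigma(x),s(x),x}\Big\},$$ with $Z_n$ the normalizing constant. The compatibility condition is: for all $n\ge2$ and all $(\sigma_{n-1},s_{n-1})\in\Omega_{V_{n-1}}$, $$\sum_{(\sigma_{[n]},s_{[n]})\in\Omega_{W_n}}\mu_n\big((\sigma_{n-1},s_{n-1})\vee(\sigma_{[n]},s_{[n]})\big)=\mu_{n-1}(\sigma_{n-1},s_{n-1}).$$ *)

(* Defs.v *)
From HB Require Import structures.
From mathcomp Require Import all_boot all_order all_algebra finmap.
From mathcomp Require Import all_classical all_reals all_analysis.

Set Implicit Arguments.
Unset Strict Implicit.
Unset Printing Implicit Defensive.

Import Order.TTheory GRing.Theory Num.Theory.

Local Open Scope classical_set_scope.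
Local Open Scope fset_scope.
Local Open Scope ring_scope.

(* A tree, i.e. a connected simple graph without cycles, all of whose vertices
   have exactly k + 1 neighbours.  For x, y adjacent [:: x; y] is already
   a [ucycle], so a genuine cycle is one with at least three vertices. *)
Record cayleyTree (k : nat) := CayleyTree {
  vertex :> choiceType;
  adj : rel vertex;
  adj_sym : symmetric adj;
  adj_irr : irreflexive adj;
  adj_degree : forall x : vertex, ([set y | adj x y] #= `I_k.+1)%card;
  adj_connected : forall x y : vertex,
    exists p : seq vertex, path adj x p /\ last x p = y;
  adj_acyclic : forall c : seq vertex, (2 < size c)%N -> ~ ucycle adj c
}.

Definition has_walk (k : nat) (G : cayleyTree k) (x y : G) : pred nat :=
  fun n => `[< exists p : seq G,
                 [/\ size p = n, path (@adj k G) x p & last x p = y] >].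

Lemma has_walk_ex (k : nat) (G : cayleyTree k) (x y : G) :
  exists n, has_walk x y n.
Proof.
have [p [xp <-]] := adj_connected x y.
by exists (size p); apply/asboolP; exists p.
Qed.

Definition dist (k : nat) (G : cayleyTree k) (x y : G) : nat :=
  ex_minn (has_walk_ex x y).

Lemma finite_adj (k : nat) (G : cayleyTree k) (x : G) :
  finite_set [set y | adj x y].
Proof. by apply/finite_setP; exists k.+1; exact: adj_degree. Qed.

Lemma finite_ball (k : nat) (G : cayleyTree k) (x0 : G) (n : nat) :
  finite_set [set x : G | (dist x x0 <= n)%N].
Proof.
elim: n => [|n IHn].
  apply: (@sub_finite_set _ _ [set x0]) (finite_set1 _) => x /=.
  rewrite /dist; case: ex_minnP => m /asboolP [p [<- _ <-]] _.
  by case: p.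
apply: (@sub_finite_set _ _ ([set x0] `|`
  \bigcup_(y in [set x : G | (dist x x0 <= n)%N]) [set z | adj y z])).
  move=> x /=; rewrite {1}/dist; case: ex_minnP => m /asboolP[[|y p] [<- /=]].
    by move=> _ <- _ _; left.
  move=> /andP[xy yp] lp _; rewrite ltnS => pn; right.
  exists y => /=; last by rewrite adj_sym.
  rewrite /dist; case: ex_minnP => m' _ /(_ (size p)) m'p.
  by apply: leq_trans pn; apply: m'p; apply/asboolP; exists p.
rewrite finite_setU; split; first exact: finite_set1.
by apply: bigcup_finite => // y _; exact: finite_adj.
Qed.

Definition ball (k : nat) (G : cayleyTree k) (x0 : G) (n : nat) : {fset G} :=
  fset_set [set x : G | (dist x x0 <= n)%N].

Definition sphere (k : nat) (G : cayleyTree k) (x0 : G) (n : nat) : {fset G} :=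
  fset_set [set x : G | dist x x0 = n].

Definition succs (k : nat) (G : cayleyTree k) (x0 x : G) : {fset G} :=
  [fset y in sphere x0 (dist x x0).+1 | dist x y == 1%N].

Lemma in_ball (k : nat) (G : cayleyTree k) (x0 : G) (n : nat) (x : G) :
  (x \in ball x0 n) = (dist x x0 <= n)%N.
Proof.
rewrite in_fset_set; last exact: finite_ball.
by apply/idP/idP; rewrite inE.
Qed.

Lemma in_sphere (k : nat) (G : cayleyTree k) (x0 : G) (n : nat) (x : G) :
  (x \in sphere x0 n) = (dist x x0 == n).
Proof.
rewrite in_fset_set; first by apply/idP/eqP; rewrite inE.
by apply: sub_finite_set (finite_ball x0 n) => y /= ->.
Qed.

Lemma ball_sphere (k : nat) (G : cayleyTree k) (x0 : G) (n : nat) (x : G) :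
  x \in ball x0 n -> ~~ (x \in ball x0 n.-1) -> x \in sphere x0 n.
Proof.
rewrite !in_ball in_sphere -ltnNge eqn_leq => -> /=.
by case: n.
Qed.

(* [true] is the spin value 1 and [false] the spin value -1. *)
Definition Phi : finType := bool.

Definition spin (R : realType) (i : Phi) : R := if i then 1 else -1.

(* The colour j in {1, ..., q} is the ordinal of value j - 1. *)
Definition Psi (q : nat) : finType := 'I_q.

Lemma last_colour_subproof (q : nat) : (3 <= q)%N -> (q.-1 < q)%N.
Proof. by case: q. Qed.

Definition last_colour (q : nat) (hq : (3 <= q)%N) : Psi q :=
  Ordinal (last_colour_subproof hq).

Definition config (k q : nat) (G : cayleyTree k) (A : {fset G}) : finType :=
  {ffun A -> Phi * Psi q}.

Definition concat (k q : nat) (G : cayleyTree k) (x0 : G) (n : nat)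
    (c : config q (ball x0 n.-1)) (w : config q (sphere x0 n)) :
    config q (ball x0 n) :=
  [ffun x : ball x0 n =>
     match boolP (val x \in ball x0 n.-1) with
     | AltTrue xin => c [` xin]
     | AltFalse xout => w [` ball_sphere (valP x) xout]
     end].

(* Sum over the unordered edges with both endpoints in the ball of radius n,
   for F symmetric on edges: each edge <x, y> occurs as (x, y) and (y, x). *)
Definition edge_sum (R : realType) (k : nat) (G : cayleyTree k) (x0 : G)
    (n : nat) (F : ball x0 n -> ball x0 n -> R) : R :=
  2^-1 * \sum_(x : ball x0 n) \sum_(y : ball x0 n | adj (val x) (val y)) F x y.

Definition hamiltonian (R : realType) (k q : nat) (G : cayleyTree k) (x0 : G)
    (alpha : R) (JI JP : G -> G -> R) (n : nat)
    (c : config q (ball x0 n)) : R :=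
  - alpha * edge_sum (fun x y =>
      JI (val x) (val y) * spin R (c x).1 * spin R (c y).1)
  - (1 - alpha) * edge_sum (fun x y =>
      JP (val x) (val y) * ((c x).2 == (c y).2)%:R).

Definition weight (R : realType) (k q : nat) (G : cayleyTree k) (x0 : G)
    (alpha beta : R) (JI JP : G -> G -> R) (h : Phi -> Psi q -> G -> R)
    (n : nat) (c : config q (ball x0 n)) : R :=
  expR (- beta * hamiltonian alpha JI JP c
        + \sum_(x : ball x0 n | val x \in sphere x0 n)
            h (c x).1 (c x).2 (val x)).

Definition mu (R : realType) (k q : nat) (G : cayleyTree k) (x0 : G)
    (alpha beta : R) (JI JP : G -> G -> R) (h : Phi -> Psi q -> G -> R)
    (n : nat) (c : config q (ball x0 n)) : R :=
  (\sum_(c' : config q (ball x0 n)) weight alpha beta JI JP h c')^-1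
  * weight alpha beta JI JP h c.

Definition compatible (R : realType) (k q : nat) (G : cayleyTree k) (x0 : G)
    (alpha beta : R) (JI JP : G -> G -> R) (h : Phi -> Psi q -> G -> R) : Prop :=
  forall n : nat, (2 <= n)%N -> forall c : config q (ball x0 n.-1),
    \sum_(w : config q (sphere x0 n)) mu alpha beta JI JP h (concat c w)
    = mu alpha beta JI JP h c.

Definition theta (R : realType) (k : nat) (G : cayleyTree k)
    (beta : R) (J : G -> G -> R) (x y : G) : R :=
  expR (beta * J x y).

Definition zeta (R : realType) (k q : nat) (hq : (3 <= q)%N) (G : cayleyTree k)
    (h : Phi -> Psi q -> G -> R) (i : Phi) (j : Psi q) (x : G) : R :=
  expR (h i j x - h false (last_colour hq) x).

(* Main.v *)
Require Import Defs.
From HB Require Import structures.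
From mathcomp Require Import all_boot all_order all_algebra finmap.
From mathcomp Require Import all_classical all_reals all_analysis.
From mathcomp Require Import ring.

Set Implicit Arguments.
Unset Strict Implicit.
Unset Printing Implicit Defensive.

Import Order.TTheory GRing.Theory Num.Theory.

Local Open Scope ring_scope.

(** Why the theorem holds. In a tree every vertex of the sphere of radius
    [n.+1] has exactly one neighbour in the ball of radius [n.+1], its parent
    in the sphere of radius [n] ([neighbour_inner_unique], [big_parent]). Hence
    the energy of the larger ball is the energy of the smaller one plus one term
    for each new vertex ([ball_bondsS]), and summing the weight over the spins of
    the new sphere gives
      exp (- beta H_n) * \prod_(x in W_n) \prod_(y in S(x)) A_(x,y)(s_x),
    where A_(x,y)(s) sums the edge and boundary weights over the spin of [y]
    ([sum_weight_concat]; the inner product over [y] is [branch]). The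
    weight of the smaller ball is the same expression with the boundary weight
    exp (h_(s_x, x)) in place of the inner product. So compatibility says that
    two products over the sphere, whose factors depend on one spin each, are
    proportional with a ratio that does not depend on the configuration.

    Varying one spin at a time, this is equivalent to a condition at each
    vertex: the ratio of branch to boundary weight at [x] is the same for all
    spins ([compatible_branch]). In the converse direction the constant is also
    the ratio of the two normalizing constants, because a configuration on the
    larger ball is a configuration on the smaller one together with one on the
    new sphere ([sum_concat]). Comparing an arbitrary spin with the reference
    spin (-1, q) and computing A_(x,y)(i, j) / A_(x,y)(-1, q) in terms of theta
    and z ([bond_ratio]) turns the condition into the stated recursion.

    Configurations on a finite set are handled as restrictions of functions
    defined on the whole tree, so that balls of different radii can share
    the same formulas. *)

(** * Distances and spheres in the tree *)

Section Tree.

Variables (k : nat) (G : cayleyTree k) (x0 : G).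
Implicit Types (x y z : G) (n : nat).

Lemma dist_walk x y :
  exists p : seq G, [/\ size p = dist x y, path (@adj k G) x p & last x p = y].
Proof. by rewrite /dist; case: ex_minnP => m /asboolP. Qed.

Lemma dist_le_size x (p : seq G) :
  path (@adj k G) x p -> (dist x (last x p) <= size p)%N.
Proof.
rewrite /dist; case: ex_minnP => m _ m_min xp; apply: m_min.
by apply/asboolP; exists p.
Qed.

Lemma dist_eq0 x y : (dist x y == 0)%N = (x == y).
Proof.
apply/eqP/eqP => [xy0|->].
  by have [[|z p] [sp _ //]] := dist_walk x y; rewrite xy0 in sp.
by apply/eqP; rewrite -leqn0; exact: (@dist_le_size y [::]).
Qed.

Lemma dist_adj x y : adj x y -> (dist x x0 <= (dist y x0).+1)%N.
Proof.
move=> xy; have [p [<- yp <-]] := dist_walk y x0.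
by apply: (@dist_le_size x (y :: p)); rewrite /= xy.
Qed.

Lemma dist_eq1 x y : (dist x y == 1)%N = adj x y.
Proof.
apply/eqP/idP => [xy1|xy].
  have [[|z [|t s]] []] := dist_walk x y; rewrite xy1 //=.
  by move=> _; rewrite andbT => ? <-.
apply/eqP; rewrite eqn_leq; apply/andP; split.
  by apply: (@dist_le_size x [:: y]); rewrite /= xy.
rewrite lt0n dist_eq0; apply: contraTneq xy => ->.
by rewrite adj_irr.
Qed.

Lemma exists_closer_neighbour n x :
  dist x x0 = n.+1 -> exists2 y, dist y x0 = n & adj y x.
Proof.
move=> xn; have [[|y p] []] := dist_walk x x0; rewrite xn //= => -[sp].
move=> /andP[xy yp] lp; exists y; last by rewrite adj_sym.
apply/eqP; rewrite eqn_leq -{1}sp -{1}lp dist_le_size //=.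
by have := dist_adj xy; rewrite xn.
Qed.

(** Following closer neighbours, the distance to the root decreases at every
    step, so the walk never returns to its initial level. *)
Lemma descending_walk n x : dist x x0 = n ->
  exists p : seq G, [/\ path (@adj k G) x p, last x p = x0 &
    forall y, y \in p -> (dist y x0 < n)%N].
Proof.
elim: n x => [|n IHn] x xn.
  by exists [::]; split=> //=; apply/eqP; rewrite -dist_eq0 xn.
have [y yn yx] := exists_closer_neighbour xn.
have [p [yp lp pn]] := IHn y yn.
exists (y :: p); split=> //=; first by rewrite adj_sym yx.
move=> z; rewrite inE => /predU1P[->|/pn]; first by rewrite yn.
by move/ltn_trans; apply.
Qed.

(** Two such neighbours would be joined, through the root, by a walk that
    avoids [y]; shortened to a simple path and closed up at [y], it is a
    cycle. *)
Lemma neighbour_inner_unique n x x' y : dist y x0 = n ->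
  (dist x x0 <= n)%N -> (dist x' x0 <= n)%N ->
  adj x y -> adj x' y -> x = x'.
Proof.
move=> yn xn x'n xy x'y; apply: contrapT => /eqP xx'.
have notin (z : G) (p : seq G) : (dist z x0 <= n)%N -> adj z y ->
    (forall t, t \in p -> (dist t x0 < dist z x0)%N) -> y \notin z :: p.
  move=> zn zy pz; rewrite inE negb_or; apply/andP; split.
    by apply: contraTneq zy => ->; rewrite adj_irr.
  apply/negP => /pz; rewrite yn; rewrite ltnNge zn; exact/negP.
have [p [xp lp /(notin _ _ xn xy) yp]] := descending_walk (erefl (dist x x0)).
have [p' [xp' lp' /(notin _ _ x'n x'y) yp']] :=
  descending_walk (erefl (dist x' x0)).
(* Down from [x] to the root, then up to [x']. *)
pose w := p ++ rev (belast x' p').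
have xw : path (@adj k G) x w.
  rewrite cat_path xp lp -lp' /= rev_path.
  by rewrite (eq_path (fun a b => adj_sym b a)).
have lw : last x w = x'.
  rewrite /w last_cat lp -lp'; case: (p') => [|a s] //=.
  by rewrite rev_cons last_rcons.
have yw : y \notin x :: w.
  rewrite /w -cat_cons mem_cat negb_or yp /= mem_rev.
  by apply: contra yp'; exact: mem_belast.
case/shortenP: xw lw => s xs us sw ls.
have s0 : s != [::] by case: (s) ls => //= xe; rewrite xe eqxx in xx'.
apply: (@adj_acyclic _ G (y :: x :: s)); first by case: (s) s0.
apply/andP; split; first by rewrite /= rcons_path xs ls x'y adj_sym xy.
rewrite cons_uniq us andbT; apply: contra yw.
by rewrite !inE => /predU1P[->|/sw ->]; rewrite ?eqxx ?orbT.
Qed.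

(** Adjacent to a vertex of its own sphere, [y] would have a second neighbour
    no farther from the root, besides its parent. *)
Lemma adj_sphereF n x y :
  x \in sphere x0 n -> y \in sphere x0 n -> adj x y = false.
Proof.
rewrite !in_sphere => /eqP xn /eqP yn; apply/negP => xy.
case: n => [|n] in xn yn *.
  move: xy; have -> : x = y; last by rewrite adj_irr.
  by apply/eqP; move/eqP: xn; move/eqP: yn; rewrite !dist_eq0 => /eqP-> /eqP->.
have [z zn zy] := exists_closer_neighbour yn.
have zx : z = x by apply: (neighbour_inner_unique yn); rewrite ?zn ?xn.
by move: zn; rewrite zx xn => /eqP; rewrite eqn_leq ltnn.
Qed.

(** A big operator over the inner neighbours of [y] has a single term, the parent
    of [y]. The operator is arbitrary because sums of energies and products of
    weights both collapse in this way. *)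
Lemma big_parent n y : y \in sphere x0 n.+1 ->
  exists2 x, x \in sphere x0 n &
    forall (T : Type) (idx : T) (op : Monoid.com_law idx) (F : G -> T),
      \big[op/idx]_(x <- Defs.ball x0 n | adj x y) F x = F x /\
      \big[op/idx]_(x <- sphere x0 n | adj x y) F x = F x.
Proof.
rewrite in_sphere => /eqP yn; have [x xn xy] := exists_closer_neighbour yn.
exists x => [|T idx op F]; first by rewrite in_sphere xn.
have only (A : {fset G}) : {subset A <= Defs.ball x0 n} -> x \in A ->
    \big[op/idx]_(x <- A | adj x y) F x = F x.
  move=> sA xA; rewrite big_mkcond (bigD1_seq x) //= xy.
  rewrite big1_seq ?Monoid.mulm1 // => z /andP[zx /sA].
  rewrite in_ball => zn; case: ifP => // zy; case/eqP: zx.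
  by apply: (neighbour_inner_unique yn); rewrite ?xn // ltnW.
split; apply: only => //; last by rewrite in_sphere xn.
- by rewrite in_ball xn.
- by move=> z; rewrite in_ball in_sphere => /eqP->.
Qed.

Lemma big_succs (T : Type) (idx : T) (op : Monoid.com_law idx) n x
    (F : G -> T) : x \in sphere x0 n ->
  \big[op/idx]_(y <- succs x0 x) F y =
  \big[op/idx]_(y <- sphere x0 n.+1 | adj x y) F y.
Proof.
rewrite in_sphere /succs => /eqP ->; rewrite -big_fset_condE.
by apply: eq_bigl => y; rewrite dist_eq1.
Qed.

(** The sphere of radius [n.+1] is the disjoint union of the families of
    successors of the vertices of the sphere of radius [n]. *)
Lemma big_sphereS (T : Type) (idx : T) (op : Monoid.com_law idx) n
    (F : G -> G -> T) :
  \big[op/idx]_(y <- sphere x0 n.+1) \big[op/idx]_(x <- sphere x0 n | adj x y)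
     F x y =
  \big[op/idx]_(x <- sphere x0 n) \big[op/idx]_(y <- succs x0 x) F x y.
Proof.
rewrite (exchange_big_dep xpredT) //=; apply: eq_big_seq => x xn.
by rewrite (big_succs _ _ xn).
Qed.

Lemma big_ballS (T : Type) (idx : T) (op : Monoid.com_law idx) n
    (P : pred G) (F : G -> T) :
  \big[op/idx]_(x <- Defs.ball x0 n.+1 | P x) F x =
  op (\big[op/idx]_(x <- Defs.ball x0 n | P x) F x)
     (\big[op/idx]_(x <- sphere x0 n.+1 | P x) F x).
Proof.
rewrite -big_cat; apply: perm_big; apply: uniq_perm => //.
  rewrite cat_uniq !fset_uniq andbT; apply/hasPn => x /=.
  by rewrite in_sphere in_ball => /eqP->; rewrite ltnn.
by move=> x; rewrite mem_cat !in_ball in_sphere leq_eqVlt orbC.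
Qed.

End Tree.

(** * Configurations as restrictions *)

Section Configurations.

Variables (k q : nat) (G : cayleyTree k) (x0 : G).

Definition restr (A : {fset G}) (f : G -> Phi * Psi q) : config q A :=
  [ffun x => f (val x)].

Definition extend (A : {fset G}) (f : G -> Phi * Psi q) (c : config q A) :
  G -> Phi * Psi q := fun x => if insub x is Some u then c u else f x.

Lemma extend_in (A : {fset G}) f (c : config q A) (u : A) :
  extend f c (val u) = c u.
Proof. by rewrite /extend valK. Qed.

Lemma extend_out (A : {fset G}) f (c : config q A) x :
  x \notin A -> extend f c x = f x.
Proof. by move=> xA; rewrite /extend insubN. Qed.

Lemma restr_extend (A : {fset G}) f (c : config q A) : restr A (extend f c) = c.
Proof. by apply/ffunP => u; rewrite ffunE extend_in. Qed.

(** A match on [boolP b] cannot be destructed directly when its branches use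
    the proof of [b] in a dependent way; here the result type is constant. *)
Lemma alt_match_eq (T : Type) (P : Prop) (b b' : bool) (a : alt_spec P b b')
    (F1 : P -> T) (F2 : ~~ b -> T) (v : T) :
  (forall p, F1 p = v) -> (forall p, F2 p = v) ->
  match a with AltTrue p => F1 p | AltFalse p => F2 p end = v.
Proof. by case: a. Qed.

Lemma concat_restr n f (w : config q (sphere x0 n.+1)) :
  @concat k q G x0 n.+1 (restr (Defs.ball x0 n) f) w =
  restr (Defs.ball x0 n.+1) (extend f w).
Proof.
apply/ffunP => u; rewrite !ffunE; apply: alt_match_eq => [uin|uout].
  rewrite ffunE extend_out //=; move: uin; rewrite in_sphere in_ball => un.
  by apply: contraTneq un => ->; rewrite ltnn.
set v := FSetSub _; have -> : val u = val v by [].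
by rewrite extend_in.
Qed.

(** Since the ball of radius [n.+1] is the disjoint union of the ball of radius
    [n] and the sphere of radius [n.+1], [concat] is a bijection. *)
Lemma sum_concat (R : realType) n (F : config q (Defs.ball x0 n.+1) -> R)
    (s : Phi * Psi q) :
  \sum_c F c = \sum_(c : config q (Defs.ball x0 n)) \sum_w
                 F (@concat k q G x0 n.+1 c w).
Proof.
rewrite pair_big /= (reindex (fun p : config q (Defs.ball x0 n) *
  config q (sphere x0 n.+1) => @concat k q G x0 n.+1 p.1 p.2)) //=.
pose out (c : config q (Defs.ball x0 n.+1)) := extend (fun=> s) c.
exists (fun c => (restr (Defs.ball x0 n) (out c),
                  restr (sphere x0 n.+1) (out c))) => [[c w] _|c _] /=.
  rewrite -{1 2}[c](restr_extend (fun=> s)) concat_restr /out.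
  have agree x : x \in Defs.ball x0 n.+1 ->
      extend (fun=> s) (restr (Defs.ball x0 n.+1) (extend (extend (fun=> s) c) w)) x
      = extend (extend (fun=> s) c) w x.
    by move=> xb; rewrite -[x]/(val [` xb]%fset) extend_in ffunE.
  congr pair; apply/ffunP => u; rewrite ffunE agree.
  - rewrite extend_out ?extend_in //; have := valP u.
    by rewrite in_sphere in_ball => un; apply: contraTneq un => ->; rewrite ltnn.
  - by have := valP u; rewrite !in_ball; exact: leqW.
  - by rewrite extend_in.
  - by have := valP u; rewrite in_ball in_sphere => /eqP ->.
rewrite concat_restr -[RHS](restr_extend (fun=> s)); apply/ffunP => u.
rewrite !ffunE; case: (boolP (val u \in sphere x0 n.+1)) => us.
  by rewrite -[val u]/(val [` us]%fset) extend_in ffunE.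
by rewrite extend_out.
Qed.

End Configurations.

(** * Energies, weights and summation over the outer sphere *)

Section Weights.

Variables (R : realType) (k q : nat) (G : cayleyTree k) (x0 : G).
Variables (alpha beta : R) (JI JP : G -> G -> R) (h : Phi -> Psi q -> G -> R).
Hypotheses (JI_sym : forall x y : G, adj x y -> JI x y = JI y x)
           (JP_sym : forall x y : G, adj x y -> JP x y = JP y x).
Implicit Types (x y : G) (s t : Phi * Psi q) (f : G -> Phi * Psi q).

(** Minus the energy of an edge whose ends carry [s] and [t]. *)
Definition bond x y s t : R :=
  alpha * (JI x y * spin R s.1 * spin R t.1) +
  (1 - alpha) * (JP x y * (s.2 == t.2)%:R).

Definition ball_bonds n f : R :=
  2^-1 * \sum_(x <- Defs.ball x0 n) \sum_(y <- Defs.ball x0 n | adj x y)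
     bond x y (f x) (f y).

Lemma bondC x y s t : adj x y -> bond x y s t = bond y x t s.
Proof.
move=> xy; rewrite /bond (JI_sym xy) (JP_sym xy) eq_sym.
by rewrite -!mulrA [spin R s.1 * _]mulrC.
Qed.

Lemma hamiltonian_restr n f :
  hamiltonian alpha JI JP (restr (Defs.ball x0 n) f) = - ball_bonds n f.
Proof.
rewrite /hamiltonian /edge_sum /ball_bonds big_seq_fsetE /=.
rewrite mulNr -opprD; congr (- _).
rewrite [alpha * _]mulrCA [(1 - alpha) * _]mulrCA -mulrDr; congr (_ * _).
rewrite !mulr_sumr -big_split /=; apply: eq_bigr => x _.
rewrite !mulr_sumr big_seq_fsetE -big_split /=; apply: eq_bigr => y _.
by rewrite !ffunE.
Qed.

(** Passing from radius [n] to [n.+1] only creates the edges that join a vertex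
    of the new sphere to its parent; the two orientations in which each edge is
    counted absorb the factor one half. *)
Lemma ball_bondsS n f :
  ball_bonds n.+1 f = ball_bonds n f +
    \sum_(y <- sphere x0 n.+1) \sum_(x <- sphere x0 n | adj x y)
      bond x y (f x) (f y).
Proof.
rewrite /ball_bonds; set E := (X in _ = _ + X).
have ES : \sum_(y <- sphere x0 n.+1) \sum_(x <- Defs.ball x0 n | adj x y)
    bond x y (f x) (f y) = E.
  apply: eq_big_seq => y /big_parent[x _ H].
  by rewrite (H _ _ _ _).1 (H _ _ _ _).2.
have -> : \sum_(x <- Defs.ball x0 n.+1) \sum_(y <- Defs.ball x0 n.+1 | adj x y)
    bond x y (f x) (f y) =
    \sum_(x <- Defs.ball x0 n) \sum_(y <- Defs.ball x0 n | adj x y)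
      bond x y (f x) (f y) + (E + E).
  rewrite big_ballS /=; under eq_bigr do rewrite big_ballS.
  rewrite big_split /= -addrA; congr (_ + (_ + _)).
    by rewrite (exchange_big_dep xpredT) //=.
  rewrite -ES; apply: eq_big_seq => y yW.
  rewrite big_ballS /= [X in _ + X]big1_seq; last first.
    by move=> x /andP[yx xW]; rewrite (adj_sphereF yW xW) in yx.
  rewrite addr0; apply: eq_big => x; first by rewrite adj_sym.
  exact: bondC.
by rewrite mulrDr; congr (_ + _); field.
Qed.

Lemma weight_restr n f :
  weight alpha beta JI JP h (restr (Defs.ball x0 n) f) =
  expR (beta * ball_bonds n f) *
  \prod_(x <- sphere x0 n) expR (h (f x).1 (f x).2 x).
Proof.
rewrite /weight hamiltonian_restr mulrNN expRD -expR_sum; congr (_ * expR _).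
under eq_bigr do rewrite !ffunE.
rewrite -(big_seq_fsetE _ _ (fun x => x \in sphere x0 n)
            (fun x => h (f x).1 (f x).2 x)).
rewrite -big_filter; apply: perm_big; apply: uniq_perm => //.
  by rewrite filter_uniq.
move=> x; rewrite mem_filter in_ball in_sphere.
by apply/andb_idr => /eqP ->.
Qed.

(** The total weight of the spins that the successors of [x] can take, when
    [x] carries [s]. *)
Definition branch x s : R :=
  \prod_(y <- succs x0 x) \sum_t expR (beta * bond x y s t + h t.1 t.2 y).

Lemma branch_gt0 x s : (0 < q)%N -> 0 < branch x s.
Proof.
move=> q0; apply: prodr_gt0 => y _.
rewrite (bigD1 (true, Ordinal q0)) //=.
by rewrite ltr_pwDl ?expR_gt0 // sumr_ge0 // => t _; exact: expR_ge0.
Qed.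

(** Conditionally on the spins inside, the spins of the new sphere are
    independent, because each of them interacts with its parent only: the sum
    over the new sphere is a product of sums over single spins. *)
Lemma sum_weight_concat n f :
  \sum_w weight alpha beta JI JP h
      (@concat k q G x0 n.+1 (restr (Defs.ball x0 n) f) w) =
  expR (beta * ball_bonds n f) * \prod_(x <- sphere x0 n) branch x (f x).
Proof.
pose g y t := \prod_(x <- sphere x0 n | adj x y)
  expR (beta * bond x y (f x) t + h t.1 t.2 y).
have far (w : config q (sphere x0 n.+1)) x :
    x \in Defs.ball x0 n -> extend f w x = f x.
  rewrite in_ball => xn; apply: extend_out; rewrite in_sphere.
  by apply: contraTneq xn => ->; rewrite ltnn.
have sub x : x \in sphere x0 n -> x \in Defs.ball x0 n.
  by rewrite in_sphere in_ball => /eqP ->.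
have weightE (w : config q (sphere x0 n.+1)) :
    weight alpha beta JI JP h
      (@concat k q G x0 n.+1 (restr (Defs.ball x0 n) f) w) =
    expR (beta * ball_bonds n f) * \prod_(y : sphere x0 n.+1) g (val y) (w y).
  rewrite concat_restr weight_restr ball_bondsS mulrDr expRD -mulrA.
  congr (expR (beta * (_ * _)) * _).
    apply: eq_big_seq => x xb; rewrite big_seq_cond [RHS]big_seq_cond.
    by apply: eq_bigr => y /andP[yb _]; rewrite !far.
  rewrite mulr_sumr expR_sum -big_split /= big_seq_fsetE /=.
  apply: eq_bigr => y _; rewrite !extend_in.
  have [x xW H] := big_parent (valP y).
  by rewrite /g !(H _ _ _ _).2 far ?sub // expRD.
rewrite (eq_bigr _ (fun w _ => weightE w)).
rewrite -mulr_sumr; congr (_ * _).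
rewrite -(bigA_distr_bigA (fun (y : sphere x0 n.+1) t => g (val y) t)).
rewrite -(big_seq_fsetE _ _ xpredT (fun y => \sum_t g y t)) /branch.
rewrite -big_sphereS; apply: eq_big_seq => y /big_parent[x _ H].
by rewrite (H _ _ _ _).2; apply: eq_bigr => t _; rewrite /g (H _ _ _ _).2.
Qed.

End Weights.

(** * Compatibility as a condition at each vertex *)

(** Changing [f] at the single site [x] changes one factor on each side, and
    the remaining factors cancel. *)
Lemma prod_proportional (R : fieldType) (I : choiceType) (T : Type)
    (W : {fset I}) (A B : I -> T -> R) (c : R) :
  (forall x t, A x t != 0) ->
  (forall f : I -> T, \prod_(x <- W) A x (f x) = c * \prod_(x <- W) B x (f x)) ->
  forall x t t0, x \in W -> A x t * B x t0 = A x t0 * B x t.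
Proof.
move=> A0 AB x t t0 xW.
pose rest (C : I -> T -> R) := \prod_(y <- W | y != x) C y t0.
have split (C : I -> T -> R) s :
    \prod_(y <- W) C y (if y == x then s else t0) = C x s * rest C.
  rewrite (bigD1_seq x) //= eqxx; congr (_ * _).
  by apply: eq_bigr => y /negbTE ->.
have ABs s : A x s * rest A = c * (B x s * rest B).
  by have := AB (fun y => if y == x then s else t0); rewrite !split.
have rA0 : rest A != 0 by rewrite prodf_seq_neq0; apply/allP => y _; apply/implyP.
apply: (mulIf rA0).
by rewrite mulrAC ABs [RHS]mulrAC ABs; ring.
Qed.

Section Compatibility.

Variables (R : realType) (k q : nat) (G : cayleyTree k) (x0 : G).
Variables (alpha beta : R) (JI JP : G -> G -> R) (h : Phi -> Psi q -> G -> R).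
Hypotheses (JI_sym : forall x y : G, adj x y -> JI x y = JI y x)
           (JP_sym : forall x y : G, adj x y -> JP x y = JP y x).

Local Notation wt := (weight alpha beta JI JP h).
Local Notation br := (branch x0 alpha beta JI JP h).

Lemma partition_gt0 n (s0 : Phi * Psi q) :
  0 < \sum_(c : config q (Defs.ball x0 n)) wt c.
Proof.
rewrite (bigD1 [ffun=> s0]) //= ltr_pwDl ?expR_gt0 // sumr_ge0 // => c _.
exact: expR_ge0.
Qed.

(** After the common factor coming from the bonds is cancelled, compatibility
    at radius [n.+1] says that the product of the branch weights over the
    sphere of radius [n] is proportional, with a constant ratio, to the product
    of the boundary weights; this amounts to a condition at each site. The
    radius [n] is at least [1], which is why the root is exempt. *)
Lemma compatible_branch (s0 : Phi * Psi q) :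
  compatible x0 alpha beta JI JP h <->
  forall x, x != x0 -> forall s,
    br x s * expR (h s0.1 s0.2 x) = br x s0 * expR (h s.1 s.2 x).
Proof.
have q0 : (0 < q)%N by apply: leq_ltn_trans (ltn_ord s0.2).
split=> [comp x xx0 s|site [//|n] n1 c].
  have := comp (dist x x0).+1; rewrite ltnS lt0n dist_eq0 => /(_ xx0) /= compx.
  set n := dist x x0 in compx.
  pose Z m := \sum_(c : config q (Defs.ball x0 m)) wt c.
  have Z0 m : Z m != 0 by rewrite gt_eqF // partition_gt0.
  apply: (@prod_proportional R G _ (sphere x0 n) br
    (fun x s => expR (h s.1 s.2 x)) (Z n.+1 * (Z n)^-1)) => [y t|f|].
  - by rewrite gt_eqF // branch_gt0.
  - have := compx (restr (Defs.ball x0 n) f).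
    rewrite /mu -mulr_sumr (sum_weight_concat x0 alpha beta h JI_sym JP_sym).
    rewrite weight_restr -/(Z n) -/(Z n.+1).
    set e := expR _; have e0 : e != 0 by rewrite gt_eqF ?expR_gt0.
    rewrite ![_ * (e * _)]mulrCA => /(mulfI e0) eZ.
    by rewrite -mulrA -eZ mulVKf.
  - by rewrite in_sphere.
(* At each site the ratio of branch to boundary weight has the same value for
   all spins, so the product of the ratios is a constant. *)
pose C := \prod_(x <- sphere x0 n) (br x s0 / expR (h s0.1 s0.2 x)).
have marg (d : config q (Defs.ball x0 n)) :
    \sum_w wt (@concat k q G x0 n.+1 d w) = C * wt d.
  rewrite -[d](restr_extend (fun=> s0)); set f := extend _ _.
  rewrite (sum_weight_concat x0 alpha beta h JI_sym JP_sym) weight_restr.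
  rewrite [RHS]mulrCA; congr (_ * _); rewrite /C -big_split /=.
  apply: eq_big_seq => x; rewrite in_sphere => /eqP xn.
  have xx0 : x != x0 by rewrite -dist_eq0 xn -lt0n.
  by rewrite mulrAC -site // mulfK // gt_eqF ?expR_gt0.
have C0 : C != 0.
  rewrite prodf_seq_neq0; apply/allP => x _; apply/implyP => _.
  by rewrite gt_eqF // divr_gt0 ?expR_gt0 ?branch_gt0.
rewrite /mu -mulr_sumr marg (sum_concat _ s0).
rewrite (eq_bigr _ (fun d _ => marg d)) -mulr_sumr.
by rewrite invfM -mulrA mulrCA mulKf.
Qed.

End Compatibility.

(** * The recursion in terms of theta and z *)

Section Recursion.

Variables (R : realType) (k q : nat) (hq : (3 <= q)%N) (G : cayleyTree k).
Variables (alpha beta : R) (JI JP : G -> G -> R) (h : Phi -> Psi q -> G -> R).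

Local Notation tI := (theta beta JI).
Local Notation tP := (theta beta JP).
Local Notation z := (zeta hq h).
Local Notation lq := (last_colour hq).

Lemma theta_powR (J : G -> G -> R) x y a :
  theta beta J x y `^ a = expR (beta * J x y * a).
Proof. by rewrite /theta -expRM. Qed.

Lemma sum_reweight (T : finType) (X : T -> R) (j : T) (b : R) :
  \sum_v (if j == v then b else 1) * X v = \sum_v X v + (b - 1) * X j.
Proof.
rewrite (bigD1 j) //= [in RHS](bigD1 j) //= eqxx.
rewrite (eq_bigr X) => [|v]; first by ring.
by rewrite eq_sym => /negbTE ->; rewrite mul1r.
Qed.

(** Factoring out [h] at the reference spin and the factor of [tI] for a spin
    -1 at [y] leaves only [z]; the Potts coupling acts on the colour [j] alone,
    which is the correction term. *)
Lemma sum_bond x y (i : Phi) (j : Psi q) :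
  \sum_t expR (beta * bond alpha JI JP x y (i, j) t + h t.1 t.2 y) =
  expR (h false lq y) * tI x y `^ (- (alpha * spin R i)) *
  (\sum_(v : Psi q)
     (tI x y `^ (2 * alpha * spin R i) * z true v y + z false v y)
   + (tP x y `^ (1 - alpha) - 1)
     * (tI x y `^ (2 * alpha * spin R i) * z true j y + z false j y)).
Proof.
rewrite -(sum_reweight (fun v => tI x y `^ _ * z true v y + z false v y)).
rewrite -(pair_bigA _ (fun u v =>
  expR (beta * bond alpha JI JP x y (i, j) (u, v) + h u v y))) /=.
rewrite big_bool -big_split mulr_sumr /=; apply: eq_bigr => v _.
have -> : (if j == v then tP x y `^ (1 - alpha) else 1) =
    expR (beta * JP x y * (1 - alpha) * (j == v)%:R).
  by rewrite theta_powR; case: eqP; rewrite ?mulr1 // mulr0 expR0.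
rewrite !theta_powR /zeta /bond /= !mulrDr -!expRD.
by congr (expR _ + expR _); ring.
Qed.

(** The denominator is [sum_bond] at the reference spin, cleared of the negative
    power of [tI] by the factor [tI `^ (2 * alpha)] and simplified by
    [z false lq y = 1]. *)
Lemma bond_ratio x y (i : Phi) (j : Psi q) :
  (\sum_t expR (beta * bond alpha JI JP x y (i, j) t + h t.1 t.2 y)) /
  (\sum_t expR (beta * bond alpha JI JP x y (false, lq) t + h t.1 t.2 y)) =
  tI x y `^ (alpha * (1 - spin R i))
  * (\sum_(v : Psi q)
       (tI x y `^ (2 * alpha * spin R i) * z true v y + z false v y)
     + (tP x y `^ (1 - alpha) - 1)
       * (tI x y `^ (2 * alpha * spin R i) * z true j y + z false j y))
  / (\sum_(v : Psi q | v != lq)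
       (z true v y + tI x y `^ (2 * alpha) * z false v y)
     + tP x y `^ (1 - alpha) * (z true lq y + tI x y `^ (2 * alpha))).
Proof.
set D := (X in _ = _ / X).
have denE : \sum_t expR (beta * bond alpha JI JP x y (false, lq) t
      + h t.1 t.2 y) = expR (h false lq y) * tI x y `^ (- alpha) * D.
  rewrite sum_bond -[LHS]mulrA -[RHS]mulrA; congr (_ * _).
  have zlq : z false lq y = 1 by rewrite /zeta subrr expR0.
  have flip v : z true v y + tI x y `^ (2 * alpha) * z false v y =
      tI x y `^ (2 * alpha) *
      (tI x y `^ (2 * alpha * spin R false) * z true v y + z false v y).
    rewrite mulrDr mulrA !theta_powR -expRD.
    by rewrite -mulrDr /spin mulrN1 subrr mulr0 expR0 mul1r.
  have -> : D = tI x y `^ (2 * alpha) *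
     (\sum_v (tI x y `^ (2 * alpha * spin R false) * z true v y + z false v y)
     + (tP x y `^ (1 - alpha) - 1) *
       (tI x y `^ (2 * alpha * spin R false) * z true lq y + z false lq y)).
    have fliplq := flip lq; rewrite zlq mulr1 in fliplq; rewrite /D fliplq zlq.
    rewrite (eq_bigr _ (fun v _ => flip v)) -mulr_sumr.
    rewrite [in RHS](bigD1 lq) //= zlq.
    move: (tI x y `^ _) (tI x y `^ _) (tP x y `^ _) (\sum_(v | _) _) => a b c S.
    by ring.
  rewrite [RHS]mulrA; congr (_ * _).
  by rewrite !theta_powR -expRD /spin; congr expR; ring.
have D0 : D != 0.
  apply/eqP => D0; move: denE; rewrite D0 mulr0; apply/eqP; rewrite gt_eqF //.
  rewrite (bigD1 (true, lq)) //=.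
  by rewrite ltr_pwDl ?expR_gt0 // sumr_ge0 // => t _; exact: expR_ge0.
rewrite denE sum_bond; set N := (X in _ * X / _ = _).
have -> : tI x y `^ (- (alpha * spin R i)) =
    tI x y `^ (- alpha) * tI x y `^ (alpha * (1 - spin R i)).
  by rewrite !theta_powR -expRD; congr expR; ring.
have t0 : tI x y `^ (- alpha) != 0 by rewrite theta_powR gt_eqF ?expR_gt0.
have h0 : expR (h false lq y) != 0 by rewrite gt_eqF ?expR_gt0.
have cancel (a b u n d : R) : a != 0 -> b != 0 -> d != 0 ->
    a * (b * u) * n / (a * b * d) = u * n / d.
  by move=> a0 b0 d0; field; rewrite d0 b0 a0.
exact: cancel.
Qed.

End Recursion.

(** * The theorem *)

Theorem theorem1 (R : realType) (k q : nat) (hk : (1 <= k)%N) (hq : (3 <= q)%N)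
    (alpha beta : R) (halpha : 0 <= alpha <= 1) (hbeta : 0 < beta)
    (G : cayleyTree k) (x0 : G) (JI JP : G -> G -> R)
    (JI_sym : forall x y : G, adj x y -> JI x y = JI y x)
    (JP_sym : forall x y : G, adj x y -> JP x y = JP y x)
    (h : Phi -> Psi q -> G -> R) :
  let tI := theta beta JI in
  let tP := theta beta JP in
  let z := zeta hq h in
  let lq := last_colour hq in
  compatible x0 alpha beta JI JP h <->
  (forall x : G, x != x0 ->
    (forall (i : Phi) (j : Psi q), (i, j) != (false, lq) ->
      z i j x =
      \prod_(y <- succs x0 x)
        (tI x y `^ (alpha * (1 - spin R i))
         * (\sum_(v : Psi q)
              (tI x y `^ (2 * alpha * spin R i) * z true v y + z false v y)
            + (tP x y `^ (1 - alpha) - 1)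
              * (tI x y `^ (2 * alpha * spin R i) * z true j y + z false j y))
         / (\sum_(v : Psi q | v != lq)
              (z true v y + tI x y `^ (2 * alpha) * z false v y)
            + tP x y `^ (1 - alpha)
              * (z true lq y + tI x y `^ (2 * alpha)))))
    /\ z false lq x = 1).
Proof.
move=> tI tP z lq; have q0 : (0 < q)%N by apply: leq_trans (hq).
apply: (iff_trans (compatible_branch x0 alpha beta h JI_sym JP_sym (false, lq))).
have zE i j x : z i j x = expR (h i j x) / expR (h false lq x).
  by rewrite /z /zeta expRD expRN.
have e0 i j x : expR (h i j x) != 0 by rewrite gt_eqF ?expR_gt0.
have b0 x s : branch x0 alpha beta JI JP h x s != 0.
  by rewrite gt_eqF // branch_gt0.
have ratioE i j x :
    branch x0 alpha beta JI JP h x (i, j) /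
    branch x0 alpha beta JI JP h x (false, lq) =
    \prod_(y <- succs x0 x) (
      (\sum_t expR (beta * bond alpha JI JP x y (i, j) t + h t.1 t.2 y)) /
      (\sum_t expR (beta * bond alpha JI JP x y (false, lq) t + h t.1 t.2 y))).
  by rewrite prodf_div.
split=> H x xx0.
  split=> [i j _|]; last by rewrite zE divff.
  rewrite -(eq_bigr _ (fun y _ => bond_ratio hq alpha beta JI JP h x y i j)).
  rewrite -ratioE zE; apply/eqP.
  by rewrite eqr_div // eq_sym (H x xx0 (i, j)) /= mulrC.
case=> i j; have [[-> ->]//|ij] := eqVneq (i, j) (false, lq).
have := (H x xx0).1 i j ij.
rewrite -(eq_bigr _ (fun y _ => bond_ratio hq alpha beta JI JP h x y i j)).
rewrite -ratioE zE => /eqP; rewrite eqr_div // => /eqP /= ze.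
by rewrite -ze mulrC.
Qed.
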